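(* Let $y_0\in Y$ and let $(\bar\psi(\cdot),\bar\eta(\cdot))\in\mathcal B(Y)\times\mathcal B(Y)$ be an optimal solution of the dual problem at $y_0$ (as defined in the context), assumed to exist. Let $\pi\in\Pi$ be a control plan that is periodic regime generating for $y_0$, i.e. there exist integers $T_0\ge0$ and $\mathcal T>0$ such that, for any continuous $q(y,u)$, $$E[q(y^{\pi,y_0}(t),u^{\pi,y_0}(t))]=E[q(y^{\pi,y_0}(t+\mathcal T),u^{\pi,y_0}(t+\mathcal T))]\quad\forall\,t\ge T_0.$$ If $\pi$ is optimal in the problem $$V(y_0):=\inf_{\pi'\in\Pi}\limsup_{T\to\infty}\frac1TE\Big[\sum_{t=0}^{T-1}k(y^{\pi',y_0}(t),u^{\pi',y_0}(t))\Big]$$ (i.e. $\pi$ attains this infimum) and if $V(y_0)=\hat d^*(y_0)$, then for every $t\ge T_0$, $$k(y^{\pi,y_0}(t),u^{\pi,y_0}(t))+\big(\bar\psi(y_0)-\bar\psi(y^{\pi,y_0}(t))\big)+E\big[\bar\eta(f(y^{\pi,y_0}(t),u^{\pi,y_0}(t),s(t)))\,\big|\,y^{\pi,y_0}(t)\big]-\bar\eta(y^{\pi,y_0}(t))=\hat d^*(y_0)\quad\text{a.s.}$$ and $$E[\bar\psi(y^{\pi,y_0}(t))]=\bar\psi(y_0).$$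
   Context: Model. $Y\subset\mathbb R^n$ is a nonempty compact set, $\hat U$ is a compact metric space, $S$ is a Polish space. The function $f:Y\times\hat U\times S\to\mathbb R^n$ is bounded, continuous in $(y,u)$ on $Y\times\hat U$ and Borel measurable in $s$ on $S$. The $S$-valued random elements $s(0),s(1),\dots$ are independent and identically distributed on a common probability space; $s$ denotes a generic random element with the same distribution, and $E[\varphi(f(y,u,s))]$ is the expectation over $s$ with $(y,u)$ fixed. $U(\cdot)$ is an upper semicontinuous multivalued map from $Y$ to nonempty compact subsets of $\hat U$, and $f(y,u,s)\in Y$ for all $y\in Y$, $u\in U(y)$, $s\in S$. $G:=\{(y,u): y\in Y,\ u\in U(y)\}$ (a compact set). $\Pi$ is the set of control plans $\pi=\{\pi_t(\cdot)\}_{t=0,1,\dots}$, where each $\pi_t:Y\to\hat U$ is Borel measurable with $\pi_t(y)\in U(y)$ for all $y\in Y$. For $\pi\in\Pi$ and $y_0\in Y$, the state-control trajectory $(y^{\pi,y_0}(\cdot),u^{\pi,y_0}(\cdot))$ is defined by $y(0)=y_0$, $u(t)=\pi_t(y(t))$, $y(t+1)=f(y(t),u(t),s(t))$. The function $k:Y\times\hat U\to\mathbb R$ is continuous (hence bounded). Dual problem. $\mathcal B(Y)$ is the space of bounded Borel functions on $Y$. $\hat d^*(y_0)$ is the supremum of $\mu$ over all triplets $(\mu,\psi,\eta)\in\mathbb R\times\mathcal B(Y)\times\mathcal B(Y)$ such that for all $(y,u)\in G$: $k(y,u)+(\psi(y_0)-\psi(y))+E[\eta(f(y,u,s))]-\eta(y)-\mu\ge0$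 and $E[\psi(f(y,u,s))]-\psi(y)\ge0$. A pair $(\bar\psi,\bar\eta)\in\mathcal B(Y)\times\mathcal B(Y)$ is an optimal solution of this dual problem (at $y_0$) if for all $(y,u)\in G$: $k(y,u)+(\bar\psi(y_0)-\bar\psi(y))+E[\bar\eta(f(y,u,s))]-\bar\eta(y)\ge\hat d^*(y_0)$ and $E[\bar\psi(f(y,u,s))]-\bar\psi(y)\ge0$. *)

(* Defs.v *)
From HB Require Import structures.
From mathcomp Require Import all_boot all_order all_algebra finmap.
From mathcomp Require Import all_classical all_reals all_analysis.

Set Implicit Arguments.
Unset Strict Implicit.
Unset Printing Implicit Defensive.

Import Order.TTheory GRing.Theory Num.Theory.
Import numFieldNormedType.Exports.

Local Open Scope classical_set_scope.
Local Open Scope ring_scope.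

(* [measurableType]s are pointed, so a metric space needs a point before its
   Borel sigma-algebra is available as one. *)
#[short(type="pmetricType")]
HB.structure Definition PointedMetric (K : numDomainType) :=
  {M of Metric K M & Pointed M}.

Notation borel T := (g_sigma_algebraType (@open T)).

Section Topology.

Definition polish (R : realType) (S : topologicalType) :=
  (exists d : S -> S -> R,
    [/\ forall x y, d x y = 0 <-> x = y,
        forall x y, d x y = d y x,
        forall x y z, d x z <= d x y + d y z,
        forall x : S, nbhs x =
          filter_from [set e : R | 0 < e] (fun e => [set y | d x y < e])
      & forall u : nat -> S,
          (forall e : R, 0 < e -> exists N : nat, forall i j : nat,
            (N <= i)%N -> (N <= j)%N -> d (u i) (u j) < e) ->
          exists l : S, u @ \oo --> l])
  /\ (exists D : set S, countable D /\ dense D).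

Definition upper_semicontinuous_map (X U : topologicalType) (Y : set X)
    (Uc : X -> set U) :=
  forall y, Y y -> forall V : set U, open V -> Uc y `<=` V ->
    \forall y' \near within Y (nbhs y), Uc y' `<=` V.

Definition continuous_on_prod (X U Z : topologicalType) (Y : set X)
    (g : X -> U -> Z) :=
  {within Y `*` [set: U], continuous (fun yu : X * U => g yu.1 yu.2)}.

End Topology.

Section Probability.
Context (d : measure_display) (Omega : measurableType d) (R : realType)
  (P : probability Omega R).

Definition mutually_independent (d' : measure_display) (T : measurableType d')
    (X : nat -> {RV P >-> T}) :=
  forall (J : {fset nat}) (A : nat -> set T), (forall i, measurable (A i)) ->
    P (\bigcap_(i in [set` J]) (X i @^-1` A i))
    = (\prod_(i <- J) P (X i @^-1` A i))%E.

Definition has_law (d' : measure_display) (T : measurableType d')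
    (nu : probability T R) (X : {RV P >-> T}) :=
  forall A : set T, measurable A -> distribution P X A = nu A.

(* [h] is a version of E[X | Z] := E[X | sigma(Z)]. *)
Definition is_cond_expectation (d' : measure_display) (T : measurableType d')
    (X : Omega -> R) (Z : Omega -> T) (h : Omega -> R) :=
  [/\ measurable_fun
        [set: g_sigma_algebraType (preimage_set_system setT Z measurable)] h,
      P.-integrable [set: Omega] (EFin \o h)
    & forall A : set T, measurable A ->
        (\int[P]_(w in Z @^-1` A) (h w)%:E
         = \int[P]_(w in Z @^-1` A) (X w)%:E)%E].

(* A chosen version; versions agree almost surely, and the default value is
   only met when no version exists. *)
Definition cond_expectation (d' : measure_display) (T : measurableType d')
    (X : Omega -> R) (Z : Omega -> T) : Omega -> R :=
  xget (fun=> 0) [set h | is_cond_expectation X Z h].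

End Probability.

Section Control.
Context (R : realType) (X : ptopologicalType) (U : pmetricType R).
Variables (Y : set X) (Uc : X -> set U).

(* The graph G; functions of the state are total on the ambient space [X], and
   only their values on [Y] are constrained or used. *)
Definition graph : set (X * U) := [set yu | Y yu.1 /\ Uc yu.1 yu.2].

Definition bounded_borel (phi : X -> R) :=
  measurable_fun (Y : set (borel X)) phi
  /\ exists M : R, forall y, Y y -> `|phi y| <= M.

Definition control_plan (pi : nat -> X -> U) :=
  forall t, measurable_fun (Y : set (borel X)) (pi t : borel X -> borel U)
    /\ forall y, Y y -> Uc y (pi t y).

Section Trajectory.
Context (S Omega : Type).
Variables (f : X -> U -> S -> X) (s : nat -> Omega -> S).

Fixpoint state (pi : nat -> X -> U) (y0 : X) (t : nat) (w : Omega) : X :=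
  if t is t'.+1 then
    f (state pi y0 t' w) (pi t' (state pi y0 t' w)) (s t' w)
  else y0.

Definition control (pi : nat -> X -> U) (y0 : X) (t : nat) (w : Omega) : U :=
  pi t (state pi y0 t w).

End Trajectory.

Section Averages.
Context (d : measure_display) (Omega : measurableType d)
  (P : probability Omega R) (S : Type).
Variables (f : X -> U -> S -> X) (s : nat -> Omega -> S).
Local Open Scope ereal_scope.

Definition average_cost (k : X -> U -> R) (pi : nat -> X -> U) (y0 : X) :
    \bar R :=
  limn_esup (fun T : nat => (T%:R^-1)%:E *
    'E_P[fun w => (\sum_(t < T)
           k (state f s pi y0 t w) (control f s pi y0 t w))%R]).

Definition optimal_cost (k : X -> U -> R) (y0 : X) : \bar R :=
  ereal_inf [set average_cost k pi y0 | pi in control_plan].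

Definition periodic_regime (pi : nat -> X -> U) (y0 : X) (T0 period : nat) :=
  forall q : X -> U -> R, continuous_on_prod Y q ->
    forall t, (T0 <= t)%N ->
      'E_P[fun w => q (state f s pi y0 t w) (control f s pi y0 t w)]
      = 'E_P[fun w => q (state f s pi y0 (t + period) w)
                        (control f s pi y0 (t + period) w)].

End Averages.

Section Dual.
Context (S : ptopologicalType).
Variables (nu : probability (borel S) R) (f : X -> U -> S -> X)
  (k : X -> U -> R) (y0 : X).

Definition dual_feasible (mu : R) (psi eta : X -> R) :=
  [/\ bounded_borel psi, bounded_borel eta
    & forall yu, graph yu ->
        0 <= k yu.1 yu.2 + (psi y0 - psi yu.1)
             + \int[nu]_x eta (f yu.1 yu.2 x) - eta yu.1 - mu
        /\ 0 <= \int[nu]_x psi (f yu.1 yu.2 x) - psi yu.1].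

Definition dual_value : \bar R :=
  ereal_sup [set mu%:E | mu in [set mu | exists psi eta : X -> R,
    dual_feasible mu psi eta]].

Definition dual_optimal (psi eta : X -> R) :=
  [/\ bounded_borel psi, bounded_borel eta
    & forall yu, graph yu ->
        (dual_value <= (k yu.1 yu.2 + (psi y0 - psi yu.1)
             + \int[nu]_x eta (f yu.1 yu.2 x) - eta yu.1)%:E)%E
        /\ 0 <= \int[nu]_x psi (f yu.1 yu.2 x) - psi yu.1].

End Dual.
End Control.

(* Main.v *)
(** Along the closed loop of [pi], the left-hand side of the first dual
    inequality minus the dual value is a nonnegative random variable J_t, with
    E[J_t] = E[k_t] + (psi(y0) - E[psi(y_t)]) + E[eta(y_(t+1))] - E[eta(y_t)] - c,
    because y_t is independent of s(t).  Continuous functions determine Borel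
    laws, so periodicity transfers to E[eta(y_t)]; moreover E[psi(y_t)] is
    nondecreasing in t and starts at psi(y0).  As the optimal average cost is
    the mean of E[k_t] over a period and equals c, summing over one period gives
    sum (E[J_t] + E[psi(y_t)] - psi(y0)) = 0.  All terms are nonnegative, hence
    zero, and J_t = 0 almost surely. *)

Require Import Defs.
From HB Require Import structures.
From mathcomp Require Import all_boot all_order all_algebra finmap.
From mathcomp Require Import all_classical all_reals all_analysis.
From mathcomp Require Import measurable_realfun.
From mathcomp Require Import ring.

Set Implicit Arguments.
Unset Strict Implicit.
Unset Printing Implicit Defensive.

Import Order.TTheory GRing.Theory Num.Theory.
Import numFieldNormedType.Exports.

Local Open Scope classical_set_scope.
Local Open Scope ring_scope.

(** * Functions continuous in one variable and measurable in the other *)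

(** The distance to the complement of [V] is continuous, and it is positive exactly on [V] because
    [V] is open. Applying [contract] brings it into [[0, 1]], including the value [+oo] taken when
    the complement is empty. *)
Lemma open_positivity_set (R : realType) (X : pseudoMetricType R)
    (V : set X) : open V ->
  exists2 phi : X -> R, continuous phi &
    forall x, 0 <= phi x <= 1 /\ (V x <-> 0 < phi x).
Proof.
move=> oV; exists (fun x => contract (edist_inf (~` V) x)).
  move=> x; apply/cvgrPdist_lt => e e0.
  (* Balls of the extended reals measure the distance between contractions, so continuity of the
     distance is already continuity of its contraction. *)
  have : nbhs (edist_inf (~` V) x) (ereal_ball (edist_inf (~` V) x) e).
    by apply/nbhs_ballP; exists e.
  exact: (@edist_inf_continuous R X (~` V) x).
move=> x.
have ge0 : 0 <= contract (edist_inf (~` V) x).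
  by rewrite -contract0 le_contract edist_inf_ge0.
split.
  by rewrite ge0/= (le_trans (ler_norm _))// contract_le1.
split=> [Vx|].
  rewrite lt_neqAle ge0 andbT eq_sym contract_eq0; apply/negP => /eqP d0.
  have /nbhs_ballP[e /= e0 eV] : nbhs x V by exact: open_nbhs_nbhs.
  have /ereal_inf_lt[_ [z nVz <-]] : (edist_inf (~` V) x < e%:E)%E.
    by rewrite d0 lte_fin.
  by move=> /edist_lt_ball /= /eV.
move=> c0; apply: contrapT => nVx.
by move: c0; rewrite edist_inf0// contract0 ltxx.
Qed.

(** Every open set is the positivity set of a continuous real function, so real test functions
    detect Borel measurability. *)
Lemma measurable_fun_borel_target (R : realType) (X : pseudoPMetricType R)
    d (T : measurableType d) (g : T -> X) :
  (forall phi : X -> R, continuous phi -> measurable_fun setT (phi \o g)) ->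
  measurable_fun setT (g : T -> borel X).
Proof.
move=> mg; apply: (@measurability _ _ _ (borel X) _ g (@open X)) => //.
move=> _ [V oV <-]; have [phi cphi phiV] := open_positivity_set oV.
rewrite (_ : _ `&` _ = setT `&` (phi \o g) @^-1` `]0, +oo[%classic).
  by apply: mg.
apply/seteqP; split=> t [_ /=] h; split=> //=; rewrite ?in_itv/= ?andbT.
  exact/(phiV _).2.
by move: h; rewrite in_itv/= andbT => /(phiV _).2.
Qed.

Lemma continuous_borel_measurable (R : realType) (X : ptopologicalType)
    (phi : X -> R) : continuous phi ->
  measurable_fun setT (phi : borel X -> R).
Proof.
move=> /continuousP cphi; apply: (measurability (@RGenOpens.G R)).
  exact: RGenOpens.measurableE.
move=> _ [_ [a [b ->]] <-]; rewrite setTI.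
by apply: sub_sigma_algebra; apply: cphi; exact: itv_open.
Qed.

(** Interiors appear because the balls of a [pseudoPMetricType] need not be open. *)
Lemma compact_finite_net (R : realType) (X : pseudoPMetricType R)
    (Y : set X) (e : R) : compact Y -> 0 < e ->
  exists2 s : seq X, (forall p, p \in s -> Y p) &
    forall y, Y y -> exists2 p, p \in s & (ball p e)° y.
Proof.
rewrite compact_cover => cY e0.
have [p _| y Yy |D DY YD] := cY X Y (fun p => (ball p e)°).
- exact: open_interior.
- by exists y => //; apply: nbhs_singleton; apply: nbhs_interior;
    exact: nbhsx_ballx.
- exists (enum_fset D); first by move=> p /DY; rewrite inE.
  by move=> y /YD[p /= pD py]; exists p.
Qed.

(* Cover the compact set by finitely many balls of radius [e] and replace
   [(a t, b t)] by the centre of the first ball that contains it. *)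
Lemma caratheodory_approximation (R : realType) (X U : pseudoPMetricType R)
    (Y : set X) (Z : set U) d (T : measurableType d) d' (S : measurableType d')
    (F : X -> U -> S -> R) (a : T -> X) (b : T -> U) (c : T -> S) (e : R) :
  compact Y -> compact Z -> 0 < e ->
  (forall y u, Y y -> Z u -> measurable_fun setT (F y u)) ->
  measurable_fun setT (a : T -> borel X) ->
  measurable_fun setT (b : T -> borel U) -> measurable_fun setT c ->
  (forall t, Y (a t)) -> (forall t, Z (b t)) ->
  exists2 g : T -> R, measurable_fun setT g &
    forall t, exists p : X * U, [/\ Y p.1, Z p.2, ball (a t) e p.1,
      ball (b t) e p.2 & g t = F p.1 p.2 (c t)].
Proof.
move=> cY cZ e0 mF ma mb mc Ya Zb.
pose B (p : X * U) := (ball p.1 e)° `*` (ball p.2 e)°.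
have [sY sYY Ycov] := compact_finite_net cY e0.
have [sZ sZZ Zcov] := compact_finite_net cZ e0.
pose D := [seq (p, q) | p <- sY, q <- sZ].
have DYZ p : p \in D -> Y p.1 /\ Z p.2.
  by move=> /allpairsP[[p1 p2] [/= /sYY Yp /sZZ Zp ->]].
have mB p : measurable_fun setT (fun t => (a t, b t) \in B p).
  apply: (@measurable_fun_bool _ _ _ _ true); rewrite setTI.
  rewrite (_ : _ @^-1` _ = a @^-1` (ball p.1 e)° `&` b @^-1` (ball p.2 e)°).
    by apply: measurableI; rewrite -[X in measurable X]setTI;
      [apply: ma|apply: mb] => //; apply: sub_sigma_algebra; exact: open_interior.
  by apply/seteqP; split=> t /=; [move/set_mem|move/mem_set].
pose g := foldr (fun p (h : T -> R) t =>
  if (a t, b t) \in B p then F p.1 p.2 (c t) else h t) (cst 0) D.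
exists g.
  rewrite /g {g}; elim: D DYZ => [|p s IH] DYZ /=; first exact: measurable_cst.
  have [Yp Zp] := DYZ p (mem_head _ _).
  have {}IH := IH (fun r => DYZ r \o @mem_behead _ _ r).
  apply: measurable_fun_ifT => //.
  by apply: measurableT_comp => //; exact: mF.
move=> t; have : has (fun p => (a t, b t) \in B p) D.
  have [p ps pa] := Ycov _ (Ya t); have [q qs qb] := Zcov _ (Zb t).
  apply/hasP; exists (p, q); first by apply/allpairsP; exists (p, q).
  by rewrite in_setE.
rewrite /g {g}; elim: D DYZ => //= q s IH DYZ.
have [Yq Zq] := DYZ q (mem_head _ _).
have {}IH := IH (fun r => DYZ r \o @mem_behead _ _ r).
case: ifPn => [|_ /=]; last exact: IH.
rewrite in_setE => -[/interior_subset aq /interior_subset bq] _.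
by exists q; split=> //; exact: ball_sym.
Qed.

(** A pointwise limit of the preceding approximations: for fixed [t] the chosen centres tend to
    [(a t, b t)], and [F] is continuous there once its third argument is frozen at [c t]. *)
Lemma measurable_fun_caratheodory (R : realType) (X U : pseudoPMetricType R)
    (Y : set X) d (T : measurableType d) d' (S : measurableType d')
    (F : X -> U -> S -> R) (a : T -> X) (b : T -> U) (c : T -> S) :
  compact Y -> compact [set: U] ->
  (forall x, continuous_on_prod Y (fun y u => F y u x)) ->
  (forall y u, Y y -> measurable_fun setT (F y u)) ->
  measurable_fun setT (a : T -> borel X) ->
  measurable_fun setT (b : T -> borel U) -> measurable_fun setT c ->
  (forall t, Y (a t)) ->
  measurable_fun setT (fun t => F (a t) (b t) (c t)).
Proof.
move=> cY cU cF mF ma mb mc Ya.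
have approx m : {g : T -> R | measurable_fun setT g /\
    forall t, exists p : X * U, [/\ Y p.1, ball (a t) m.+1%:R^-1 p.1,
      ball (b t) m.+1%:R^-1 p.2 & g t = F p.1 p.2 (c t)]}.
  apply: cid.
  have [//||//|||||g mg gE] := @caratheodory_approximation R X U Y setT d T
    d' S F a b c m.+1%:R^-1 cY cU => //.
    by move=> y u Yy _; exact: mF.
  by exists g; split=> // t; have [p []] := gE t; exists p.
apply: (@measurable_fun_cvg _ _ _ setT (fun m => sval (approx m))).
  by move=> m; case: (approx m) => g [].
move=> t _.
have /subspace_continuousP/(_ (a t, b t)) := cF (c t).
move=> /(_ (conj (Ya t) I)) /cvgrPdist_lt cFt.
apply/cvgrPdist_lt => e e0; have := cFt e e0.
rewrite near_withinE => /nbhs_ballP[r /= r0 rF].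
near=> m; case: (approx m) => g [mg gE] /=.
have [p [Yp ap bp ->]] := gE t.
have mr : m.+1%:R^-1 <= r.
  by apply/ltW; near: m; exact: (near_infty_natSinv_lt (PosNum r0)).
by apply: (rF p) => //; split; apply: le_ball mr _ _.
Unshelve. all: by end_near. Qed.

(** * Freezing an independent variable *)

Section BoundedIntegrals.
Context d (T : measurableType d) (R : realType) (P : probability T R).

Lemma bounded_integrable (g : T -> R) (M : R) : measurable_fun setT g ->
  (forall t, `|g t| <= M) -> P.-integrable setT (EFin \o g).
Proof.
move=> mg gM; apply: measurable_bounded_integrable => //.
  by rewrite -ge0_fin_numE ?measure_ge0 ?fin_num_measure.
exists M; split; first exact: num_real.
by move=> x Mx t _ /=; rewrite (le_trans (gM t))// ltW.
Qed.

Lemma bounded_Rintegral (g : T -> R) (M : R) : measurable_fun setT g ->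
  (forall t, `|g t| <= M) -> `|\int[P]_t g t| <= M.
Proof.
move=> mg gM; have M0 : 0 <= M by rewrite (le_trans _ (gM point)).
have ig := bounded_integrable mg gM.
rewrite (le_trans (le_normr_Rintegral _ ig))//.
have -> : M = \int[P]_(t in setT) M.
  by rewrite Rintegral_cst//= probability_setT mulr1.
apply: le_Rintegral => //; apply: (@bounded_integrable _ M).
- exact: measurableT_comp.
- by move=> t; rewrite normr_id.
- exact: measurable_cst.
- by move=> t; rewrite ger0_norm.
Qed.

Lemma EFin_bounded_Rintegral (g : T -> R) (M : R) : measurable_fun setT g ->
  (forall t, `|g t| <= M) -> (\int[P]_t g t)%:E = (\int[P]_t (g t)%:E)%E.
Proof.
move=> mg gM; rewrite /Rintegral fineK//; apply: integrable_fin_num => //.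
exact: bounded_integrable mg gM.
Qed.

Lemma ge0_Rintegral_eq0 (g : T -> R) (M : R) : measurable_fun setT g ->
  (forall t, `|g t| <= M) -> (forall t, 0 <= g t) -> \int[P]_t g t = 0 ->
  {ae P, forall t, g t = 0}.
Proof.
move=> mg gM g0 Ig0.
have mEg : measurable_fun setT (EFin \o g) by exact/measurable_EFinP.
have /(ae_eq_integral_abs P measurableT mEg) : 
    (\int[P]_(t in setT) `|(EFin \o g) t|)%E = 0%E.
  rewrite -[RHS]/(0%:E) -Ig0 (EFin_bounded_Rintegral mg gM).
  by apply: eq_integral => t _; rewrite /= ger0_norm.
by apply: filterS => t /(_ I) [].
Qed.

End BoundedIntegrals.

Section Freezing.
Context d (Omega : measurableType d) (R : realType) (P : probability Omega R).
Context d1 (T1 : measurableType d1) d2 (T2 : measurableType d2).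
Variables (Z : {RV P >-> T1}) (W : {RV P >-> T2}) (nu : probability T2 R).
(** This carries two facts at once: [Z] and [W] are independent and, with [A := setT], the law of
    [W] is [nu]. *)
Hypothesis ZW : forall A B, measurable A -> measurable B ->
  P (Z @^-1` A `&` W @^-1` B) = (P (Z @^-1` A) * nu B)%E.
Variables (H : T1 * T2 -> R) (M : R).
Hypotheses (mH : measurable_fun setT H) (HM : forall z, `|H z| <= M).

Let mH2 z1 : measurable_fun setT (fun x => H (z1, x)).
Proof. by apply: measurableT_comp => //; exact: pair1_measurable. Qed.

Lemma measurable_Rintegral_snd :
  measurable_fun setT (fun z1 => \int[nu]_x H (z1, x)).
Proof.
apply/measurable_EFinP.
rewrite (_ : _ \o _ = fubini_F nu (EFin \o H)).
  by apply: (measurable_fubini_F (m1 := distribution P Z));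
    exact: (@bounded_integrable _ _ _ (distribution P Z \x nu)%E _ _ mH HM).
apply/funext => z1 /=.
by rewrite (EFin_bounded_Rintegral nu (mH2 z1) (fun x => HM (z1, x))).
Qed.

(* Independence makes the law of [(Z, W)] a product, so that Fubini applies. *)
Lemma freezing A : measurable A ->
  (\int[P]_(w in Z @^-1` A) (H (Z w, W w))%:E =
   \int[P]_(w in Z @^-1` A) (\int[nu]_x H (Z w, x))%:E)%E.
Proof.
(* The indicator absorbs the event, leaving the full expectation of a function of [(Z, W)]. *)
move=> mA; pose f z := H z * \1_A z.1.
have mf : measurable_fun setT f.
  by apply: measurable_funM => //; apply: measurableT_comp => //;
    exact: measurable_indic.
have fM z : `|f z| <= M.
  rewrite /f normrM (le_trans _ (HM z))// ler_piMr// indicE.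
  by case: (_ \in _); rewrite ?normr1 ?normr0.
have mZW : measurable_fun setT (fun w => (Z w, W w)).
  exact/measurable_fun_pair.
pose ZWm : {mfun Omega >-> (T1 * T2)%type} :=
  HB.pack (fun w => (Z w, W w)) (isMeasurableFun.Build _ _ _ _ _ mZW).
transitivity (\int[P]_w (f (Z w, W w))%:E)%E.
  rewrite integral_mkcond; apply: eq_integral => w _.
  rewrite /f /patch /= indicE (_ : (w \in _) = (Z w \in A)).
    by case: ifP; rewrite ?mulr1 ?mulr0.
  by apply/idP/idP; rewrite !inE.
transitivity (\int[distribution P ZWm]_z (f z)%:E)%E.
  rewrite integral_distribution//; first exact/measurable_EFinP.
  by apply: (@bounded_integrable _ _ _ P _ M) => //; exact: measurableT_comp.
(* By [ZW] the two laws agree on rectangles, hence on the product sigma-algebra. *)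
transitivity (\int[distribution P Z \x nu]_z (f z)%:E)%E.
  apply: eq_measure_integral => B mB _; apply/esym.
  by apply: product_measure_unique => // A1 A2 mA1 mA2; rewrite -ZW.
rewrite -(integral12_prod_meas1 (m1 := distribution P Z)); last first.
  exact: (@bounded_integrable _ _ _ (distribution P Z \x nu)%E _ _ mf fM).
transitivity (\int[distribution P Z]_z (\int[nu]_x f (z, x))%:E)%E.
  apply: eq_integral => z _.
  rewrite /fubini_F (@EFin_bounded_Rintegral _ _ _ nu _ M)//.
  by apply: measurableT_comp => //; exact: pair1_measurable.
have fE z : \int[nu]_x f (z, x) = (\int[nu]_x H (z, x)) * \1_A z.
  rewrite /f /= RintegralZr//.
  exact: (bounded_integrable nu (mH2 z) (fun x => HM (z, x))).
under eq_integral do rewrite fE.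
rewrite integral_distribution; first last.
- apply: (@bounded_integrable _ _ _ P
      (fun w => \int[nu]_x H (Z w, x) * \1_A (Z w)) M).
    apply: measurable_funM.
      exact: (measurableT_comp measurable_Rintegral_snd).
    by apply: (@measurableT_comp _ _ _ _ _ _ (\1_A : T1 -> R)).
  move=> w /=; rewrite normrM (@le_trans _ _ `|\int[nu]_x H (Z w, x)|)//.
    by rewrite ler_piMr// indicE; case: (_ \in _); rewrite ?normr1 ?normr0.
  exact: bounded_Rintegral.
- by apply/measurable_EFinP; apply: measurable_funM;
      [exact: measurable_Rintegral_snd|exact: measurable_indic].
rewrite [RHS]integral_mkcond; apply: eq_integral => w _.
rewrite /patch /= indicE (_ : (w \in _) = (Z w \in A)).
  by case: ifP; rewrite ?mulr1 ?mulr0.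
by apply/idP/idP; rewrite !inE.
Qed.

Lemma cond_expectation_freezing :
  is_cond_expectation P (fun w => H (Z w, W w)) Z
    (fun w => \int[nu]_x H (Z w, x)).
Proof.
split.
- move=> _ B mB; rewrite setTI; apply: sub_sigma_algebra.
  exists ((fun z1 => \int[nu]_x H (z1, x)) @^-1` B); last by rewrite setTI.
  by rewrite -[X in measurable X]setTI; exact: measurable_Rintegral_snd.
- apply: (@bounded_integrable _ _ _ P _ M).
    exact: (measurableT_comp measurable_Rintegral_snd).
  by move=> w; exact: bounded_Rintegral.
- by move=> A mA; rewrite freezing.
Qed.

End Freezing.

(** * Almost sure uniqueness of conditional expectations *)

Section ConditionalExpectation.
Context d (Omega : measurableType d) (R : realType) (P : probability Omega R).
Context d' (T : measurableType d') (X : Omega -> R) (Z : {RV P >-> T}).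

Let sigmaZ := preimage_set_system setT Z measurable.

(** Preimages under [Z] already form a sigma-algebra, so generating one adds no sets. *)
Let sigmaZP D : measurable (D : set (g_sigma_algebraType sigmaZ)) ->
  exists2 A, measurable A & D = Z @^-1` A.
Proof.
rewrite measurable_g_measurableTypeE; last first.
  exact: sigma_algebra_preimage (sigma_algebra_measurable _).
by move=> [A mA <-]; exists A => //; rewrite setTI.
Qed.

Let measurable_sigmaZ (h : Omega -> R) :
  measurable_fun [set: g_sigma_algebraType sigmaZ] h ->
  measurable_fun setT h.
Proof.
move=> mh _ B mB; have [//|A mA ->] := @sigmaZP (setT `&` h @^-1` B).
  exact: mh.
by rewrite -[X in measurable X]setTI; exact: measurable_funPT.
Qed.

(* The event [h1 < h2] belongs to sigma(Z), so [h1] and [h2] have the same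
   integral over it. *)
Let cond_expectation_lt h1 h2 : is_cond_expectation P X Z h1 ->
  is_cond_expectation P X Z h2 -> P.-negligible [set w | h1 w < h2 w].
Proof.
move=> [mh1 ih1 h1X] [mh2 ih2 h2X].
have [|A mA DA] := @sigmaZP [set w | h1 w < h2 w].
  rewrite [X in measurable X](_ : _ =
    setT `&` (h2 \- h1) @^-1` `]0, +oo[%classic).
    by apply: measurable_funB.
  by rewrite setTI; apply/seteqP; split=> w /=; rewrite in_itv/= andbT subr_gt0.
have mD : measurable (Z @^-1` A).
  by rewrite -[X in measurable X]setTI; exact: measurable_funPT.
rewrite DA.
have i1 : P.-integrable (Z @^-1` A) (EFin \o h1) by apply: integrableS ih1.
have i2 : P.-integrable (Z @^-1` A) (EFin \o h2) by apply: integrableS ih2.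
have I0 : (\int[P]_(w in Z @^-1` A) `|(h2 w - h1 w)%:E| = 0)%E.
  transitivity (\int[P]_(w in Z @^-1` A) (h2 w - h1 w)%:E)%E.
    apply: eq_integral => w; rewrite -DA inE /= => h12.
    by rewrite ger0_norm// subr_ge0 ltW.
  under eq_integral do rewrite EFinB.
  rewrite integralB_EFin// h1X// -h2X// subee//.
  exact: integrable_fin_num.
have mB : measurable_fun (Z @^-1` A) (fun w => (h2 w - h1 w)%:E).
  apply/measurable_EFinP; apply: measurable_funTS.
  by apply: measurable_funB; exact: measurable_sigmaZ.
(* The difference vanishes almost everywhere on the event but is positive throughout it, so the
   event lies inside a null set. *)
have [/(_ I0)[N [mN N0 DN]] _] := ae_eq_integral_abs P mD mB.
exists N; split=> // w Aw; apply: DN => /= /(_ Aw) /eqP.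
move: Aw; rewrite -DA /= => h12.
by rewrite eqe subr_eq0 gt_eqF.
Qed.

(** Since a version exists, [xget] returns a genuine one rather than its default, and both strict
    inequalities are negligible. *)
Lemma cond_expectation_ae h : is_cond_expectation P X Z h ->
  {ae P, forall w, cond_expectation P X Z w = h w}.
Proof.
move=> Xh; have Xc : is_cond_expectation P X Z (cond_expectation P X Z).
  exact: (@xgetPex _ _ [set h | is_cond_expectation P X Z h] (ex_intro _ h Xh)).
have := negligibleU (cond_expectation_lt Xc Xh) (cond_expectation_lt Xh Xc).
apply: negligibleS => w /= /eqP; rewrite neq_lt.
by move=> /orP[]; [left|right].
Qed.

End ConditionalExpectation.

(** * Laws on a metric space *)

(** Open sets form a generating pi-system, so it suffices to recover the mass of an open set as a
    limit of integrals of bounded continuous functions. *)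
Lemma eq_continuous_integrals_eq_law (R : realType) (X : pseudoPMetricType R)
    (m1 m2 : probability (borel X) R) :
  (forall q : X -> R, continuous q -> (forall x, `|q x| <= 1) ->
    (\int[m1]_x (q x)%:E = \int[m2]_x (q x)%:E)%E) ->
  forall A : set (borel X), measurable A -> m1 A = m2 A.
Proof.
move=> m12.
apply: (@measure_unique _ R (borel X) (@open X) (fun=> setT)
  _ _ _ _ m1 m2) => //.
- exact: openI.
- by move=> _; exact: openT.
- by apply/seteqP; split=> // x _; exists 0%N.
- move=> V oV; have [phi cphi phiV] := open_positivity_set oV.
  (* Continuous functions increasing to the indicator of [V]. *)
  pose q n x := 1 - (1 - phi x) ^+ n.
  have cq n : continuous (q n).
    move=> x; apply: cvgB; first exact: cvg_cst.
    apply: (@continuous_comp _ _ _ (fun x => 1 - phi x) (fun r => r ^+ n)).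
      by apply: cvgB; [exact: cvg_cst|exact: cphi].
    exact: exprn_continuous.
  have q1 n x : `|q n x| <= 1.
    have [/andP[phi0 phi1] _] := phiV x.
    have p0 : 0 <= (1 - phi x) ^+ n by rewrite exprn_ge0// subr_ge0.
    have p1 : (1 - phi x) ^+ n <= 1.
      by rewrite exprn_ile1// ?subr_ge0// gerBl.
    by rewrite ger0_norm ?subr_ge0// gerBl.
  have mV : measurable (V : set (borel X)) by exact: sub_sigma_algebra.
  have qV x : (fun n => (q n.+1 x)%:E) @ \oo --> (\1_V x : R)%:E.
    apply: cvg_EFin; first exact: nearW.
    have [/andP[phi0 phi1] Vphi] := phiV x.
    rewrite indicE; case: (boolP (x \in V)) => [|/negP].
      rewrite inE => /Vphi phipos.
      rewrite -[X in _ --> X]subr0; apply: cvgB; first exact: cvg_cst.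
      rewrite (cvg_shiftS (fun n => (1 - phi x) ^+ n)); apply: cvg_expr.
      by rewrite ger0_norm ?subr_ge0// ltrBlDr ltrDl.
    rewrite inE => nV; have phix0 : phi x = 0.
      by apply/eqP; rewrite eq_le phi0 andbT leNgt; apply/negP => /Vphi.
    rewrite (_ : _ \o _ = cst 0); first exact: cvg_cst.
    by apply/funext => n; rewrite /= /q phix0 subr0 expr1n subrr.
  have lim (m : probability (borel X) R) :
      (fun n => \int[m]_x (q n.+1 x)%:E)%E @ \oo --> m V.
    have [|||||_ _] := @dominated_convergence _ (borel X) R m setT measurableT
      (fun n x => (q n.+1 x)%:E) (fun x => (\1_V x : R)%:E) (cst 1%E).
    + by move=> n; apply/measurable_EFinP; exact: continuous_borel_measurable.
    + by apply/measurable_EFinP.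
    + by apply: aeW => x _; exact: qV.
    + by apply: (@bounded_integrable _ _ _ m (cst 1) 1) => // t; rewrite normr1.
    + by apply: aeW => x n _; rewrite lee_fin.
    by rewrite integral_indic// setIT.
  apply: (@cvg_unique _ (@ereal_hausdorff R) _ _ _ _ (lim m1)).
  rewrite (_ : (fun n => _) = (fun n => \int[m2]_x (q n.+1 x)%:E)%E).
    exact: lim.
  by apply/funext => n; exact: m12.
- by move=> _ /=; rewrite -ge0_fin_numE ?measure_ge0 ?fin_num_measure.
Qed.

(** * Chains driven by independent noise *)

Section Past.
Context d (Omega : measurableType d) (R : realType) (P : probability Omega R).
Context d2 (T2 : measurableType d2) (s : nat -> {RV P >-> T2}).

(** The cylinder events on the noises strictly before time [t]: a pi-system generating their
    sigma-algebra, written in the shape used by [mutually_independent]. *)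
Definition past (t : nat) : set (set Omega) :=
  [set E | exists2 A : nat -> set T2, (forall i, measurable (A i)) &
     E = \bigcap_(i in [set` [fset i in iota 0 t]%fset]) (s i @^-1` A i)].

Lemma past_setI t : setI_closed (past t).
Proof.
move=> _ _ [A mA ->] [B mB ->]; exists (fun i => A i `&` B i).
  by move=> i; exact: measurableI.
apply/seteqP; split=> w.
  by move=> [hA hB] i it; split; [exact: hA|exact: hB].
by move=> h; split=> i it; have [] := h i it.
Qed.

Lemma past_measurable t (E : set Omega) :
  measurable (E : set (g_sigma_algebraType (past t))) -> measurable E.
Proof.
suff sub : <<s past t >> `<=` d.-measurable by exact: sub.
apply: smallest_sub; first exact: sigma_algebra_measurable.
move=> _ [A mA ->]; apply: bigcap_measurableType => i _.
by rewrite -[X in measurable X]setTI; exact: measurable_funPT.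
Qed.

Lemma measurable_past i t : (i < t)%N ->
  measurable_fun [set: g_sigma_algebraType (past t)] (s i).
Proof.
move=> it _ B mB; rewrite setTI; apply: sub_sigma_algebra.
exists (fun j => if j == i then B else setT); first by move=> j; case: ifP.
apply/seteqP; split=> w /=.
  by move=> Bw j _; case: eqP => // ->.
by move=> /(_ i); rewrite eqxx; apply; rewrite /= !inE mem_iota.
Qed.

Hypothesis s_indep : mutually_independent s.

Lemma past_independent t E B :
  measurable (E : set (g_sigma_algebraType (past t))) -> measurable B ->
  P (E `&` s t @^-1` B) = (P E * P (s t @^-1` B))%E.
Proof.
move=> + mB; set W := s t @^-1` B.
have mW : measurable W.
  by rewrite -[X in measurable X]setTI; exact: measurable_funPT.
apply: (@dynkin_induction _ (g_sigma_algebraType (past t)) (past t)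
  [set E | P (E `&` W) = (P E * P W)%E]) => //.
- exact: past_setI.
- by rewrite /= setTI probability_setT mul1e.
- move=> _ [A mA ->] /=.
  pose J := [fset i in iota 0 t]%fset.
  (* The event on [s t] becomes one more factor of the cylinder; since [t] is not in [J], its
     probability splits off. *)
  pose A' i := if i == t then B else A i.
  have tJ : t \notin J by rewrite !inE mem_iota ltnn.
  have A'E i : i \in J -> A' i = A i.
    by rewrite /A'; case: eqP => // ->; rewrite (negbTE tJ).
  have -> : \bigcap_(i in [set` [fset i in iota 0 t]%fset]) s i @^-1` A i `&` W
      = \bigcap_(i in [set` (t |` J)%fset]) s i @^-1` A' i.
    apply/seteqP; split=> w.
      move=> [hA hW] i /= /fset1UP[->|iJ].
        by rewrite /A' eqxx.
      by rewrite A'E//; apply: hA.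
    move=> h; split=> [i iJ|].
      by have := h i; rewrite A'E//; apply; apply/fset1UP; right.
    by have := h t; rewrite /A' eqxx; apply; apply/fset1UP; left.
  rewrite s_indep; last by move=> i; rewrite /A'; case: ifP.
  rewrite big_fsetU1//=.
  rewrite {1}/A' eqxx muleC; congr (_ * _)%E.
  by rewrite -/J (s_indep J mA); apply: eq_big_seq => i iJ; rewrite A'E.
- move=> S mS /= PS; have {}mS := past_measurable mS.
  rewrite setIC -setDE measureD//; last first.
    by rewrite -ge0_fin_numE ?measure_ge0 ?fin_num_measure.
  by rewrite setIC /= PS probability_setC// muleBl ?fin_num_measure// mul1e.
- move=> F mF tF PF /=; have {}mF n := past_measurable (mF n).
  rewrite setI_bigcupl measure_bigcup//; last exact: trivIset_setIr.
    rewrite measure_bigcup// muleC -[P W]fineK ?fin_num_measure//.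
    rewrite -nneseriesZl//; apply: eq_eseriesr => n _.
    by rewrite fineK ?fin_num_measure// muleC; exact: PF.
  by move=> n _; exact: measurableI.
Qed.

Context d1 (T1 : measurableType d1) (F : nat -> T1 * T2 -> T1)
  (Z : nat -> Omega -> T1) (z0 : T1).
Hypotheses (mF : forall t, measurable_fun setT (F t))
  (Z0 : Z 0%N = cst z0) (ZS : forall t w, Z t.+1 w = F t (Z t w, s t w)).

(** The sigma-algebra is held fixed at [t] while the induction runs over [i], so that [Z i] and
    [s i] can be combined within it. *)
Lemma chain_measurable_past i t : (i <= t)%N ->
  measurable_fun [set: g_sigma_algebraType (past t)] (Z i).
Proof.
elim: i => [_|i IH it]; first by rewrite Z0; exact: measurable_cst.
rewrite (_ : Z i.+1 = fun w => F i (Z i w, s i w)); last exact/funext.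
apply: measurableT_comp => //; apply/measurable_fun_pair => /=.
  by apply: IH; exact: ltnW.
exact: measurable_past.
Qed.

Lemma chain_measurable t : measurable_fun setT (Z t).
Proof.
move=> _ B mB; apply: (@past_measurable t).
exact: (chain_measurable_past (leqnn t)).
Qed.

(** [Z t] is built from the noises before time [t] only. *)
Lemma chain_independent t A B : measurable A -> measurable B ->
  P (Z t @^-1` A `&` s t @^-1` B) = (P (Z t @^-1` A) * P (s t @^-1` B))%E.
Proof.
move=> mA mB; apply: past_independent => //.
by rewrite -[X in measurable X]setTI; exact: chain_measurable_past.
Qed.

End Past.

(** * Averages of eventually periodic sequences *)

(** Sliding the window by one step loses a term and gains the equal term one period later. *)
Lemma sum_periodic_window (R : zmodType) (K : nat -> R) (T0 p t : nat) :
  (forall t, (T0 <= t)%N -> K (t + p)%N = K t) -> (T0 <= t)%N ->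
  \sum_(i < p) K (t + i)%N = \sum_(i < p) K (T0 + i)%N.
Proof.
move=> Kp /subnKC <-; elim: (t - T0)%N => [|m IH]; first by rewrite addn0.
rewrite -IH addnS; apply: (addIr (K (T0 + m)%N)).
transitivity (\sum_(i < p.+1) K (T0 + m + i)%N).
  rewrite big_ord_recl addn0 addrC; congr (_ + _).
  by apply: eq_bigr => i _; rewrite addSnnS.
by rewrite big_ord_recr/= Kp// leq_addr.
Qed.

(** The discrepancy [D] between the partial sum and its linear trend is periodic from [T0] on, hence
    bounded, and division by [T] kills it. *)
Lemma cvg_average_periodic (R : realType) (K : nat -> R) (T0 p : nat) :
  (0 < p)%N -> (forall t, (T0 <= t)%N -> K (t + p)%N = K t) ->
  (fun T : nat => T%:R^-1 * \sum_(i < T) K i) @ \oo -->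
    p%:R^-1 * \sum_(i < p) K (T0 + i)%N.
Proof.
move=> p0 Kp; set c := _ * _.
pose D T : R := \sum_(i < T) K i - T%:R * c.
have Dp T : (T0 <= T)%N -> D (T + p)%N = D T.
  move=> T0T; rewrite /D big_split_ord/= (sum_periodic_window Kp T0T) natrD.
  have -> : \sum_(i < p) K (T0 + i)%N = p%:R * c.
    by rewrite /c mulrA divff ?mul1r// pnatr_eq0 -lt0n.
  by rewrite mulrDl opprD addrACA subrr addr0.
(* The transient and one full period: any later value of [D] is brought into this range by
   subtracting periods. *)
pose C := \sum_(i < T0 + p) `|D i|.
have DC T : `|D T| <= C.
  have [m] := ubnP T; elim: m T => // m IH T Tm.
  have [Tlt|Tge] := ltnP T (T0 + p).
    rewrite /C (bigD1 (Ordinal Tlt))//= lerDl; exact: sumr_ge0.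
  move: Tge Tm => /subnKC <-; set j := (T - _)%N.
  rewrite addnAC => jm; rewrite Dp ?leq_addr//; apply: IH.
  by rewrite -ltnS (leq_trans _ jm)// ltnS -addn1 leq_add2l.
(* The shift to [n.+1] avoids dividing by zero at [T = 0]. *)
have : (fun n => c + n.+1%:R^-1 * D n.+1) @ \oo --> c + 0.
  apply: cvgD; first exact: cvg_cst.
  apply/norm_cvg0P; apply: (@squeeze_cvgr _ _ _ _ (cst 0)
    (fun n => n.+1%:R^-1 * C)).
  - apply: nearW => n; rewrite normr_ge0/= normrM ger0_norm ?invr_ge0//.
    by rewrite ler_wpM2l ?invr_ge0.
  - exact: cvg_cst.
  - have : (fun n => n.+1%:R^-1 * C) @ \oo --> 0 * C.
      by apply: cvgM; [exact: cvg_harmonic|exact: cvg_cst].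
    by rewrite mul0r.
rewrite addr0 (_ : (fun n => c + _) =
  (fun n => n.+1%:R^-1 * \sum_(i < n.+1) K i)).
  by move=> cD; rewrite -cvg_shiftS; exact: cD.
apply/funext => n; rewrite /D mulrBr mulrA mulVf ?pnatr_eq0// mul1r.
by rewrite addrCA subrr addr0.
Qed.

(** Adding [b - b0] to each slack cancels [b]; over a period [e] telescopes to zero and [K] sums to
    [p%:R * c]. The period is started at [t] itself, so the claim concerns its first term. *)
Lemma periodic_slackness (R : realFieldType) (K b e : nat -> R) (b0 c : R)
    (T0 p : nat) : (0 < p)%N ->
  (forall t, (T0 <= t)%N -> K (t + p)%N = K t) ->
  (forall t, (T0 <= t)%N -> e (t + p)%N = e t) ->
  (forall t, b0 <= b t) ->
  c = p%:R^-1 * \sum_(i < p) K (T0 + i)%N ->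
  (forall t, 0 <= K t + (b0 - b t) + e t.+1 - e t - c) ->
  forall t, (T0 <= t)%N ->
    K t + (b0 - b t) + e t.+1 - e t - c = 0 /\ b t = b0.
Proof.
move=> p0 Kp ep b0b cE a0 t T0t.
pose a t := K t + (b0 - b t) + e t.+1 - e t - c.
have : \sum_(i < p) (a (t + i)%N + (b (t + i)%N - b0)) = 0.
  rewrite (eq_bigr (fun i : 'I_p =>
      K (t + i)%N + (e (t + i).+1 - e (t + i)%N) - c)).
    rewrite sumrB big_split/= (sum_periodic_window Kp T0t).
    rewrite -(big_mkord xpredT (fun i => e (t + i).+1 - e (t + i)%N)).
    rewrite (eq_bigr (fun i => e (t + i.+1)%N - e (t + i)%N)); last first.
      by move=> i _; rewrite addnS.
    rewrite (telescope_sumr (fun i => e (t + i)%N))// addn0 ep// subrr addr0.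
    rewrite sumr_const card_ord cE -[_ *+ p]mulr_natl mulrA.
    rewrite divff ?mul1r ?subrr//.
    by rewrite pnatr_eq0 -lt0n.
  by move=> i _; rewrite /a; ring.
move=> /eqP; rewrite psumr_eq0; last first.
  by move=> i _; apply: addr_ge0; [exact: a0|rewrite subr_ge0].
move=> /allP /(_ (Ordinal p0)); rewrite mem_index_enum => /(_ isT) /=.
rewrite addn0 paddr_eq0; [|exact: a0|by rewrite subr_ge0].
by move=> /andP[/eqP at0 /eqP /subr0_eq].
Qed.

(** * Closed-loop trajectories *)

(** A measurable retraction onto [Y], with no claim of continuity, used to make functions controlled
    only on [Y] total. *)
Definition retract (X : Type) (Y : set X) (y0 y : X) : X :=
  if y \in Y then y else y0.

Lemma retract_in (X : Type) (Y : set X) (y0 y : X) :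
  Y y0 -> Y (retract Y y0 y).
Proof. by move=> Yy0; rewrite /retract; case: ifPn => // /set_mem. Qed.

Lemma retract_id (X : Type) (Y : set X) (y0 y : X) :
  Y y -> retract Y y0 y = y.
Proof. by move=> Yy; rewrite /retract mem_set. Qed.

Lemma measurable_retract d (X : measurableType d) (Y : set X) (y0 : X) :
  measurable Y -> measurable_fun setT (retract Y y0).
Proof.
move=> mY; apply: measurable_fun_ifT => //.
apply: (@measurable_fun_bool _ _ _ _ true); rewrite setTI.
rewrite (_ : _ @^-1` _ = Y)//.
by apply/seteqP; split=> y /=; [move/set_mem|move/mem_set].
Qed.

Lemma measurable_comp_retract d (X : measurableType d)
    d' (T : measurableType d') (Y : set X) (y0 : X) (g : X -> T) :
  measurable Y -> Y y0 ->
  measurable_fun Y g -> measurable_fun setT (g \o retract Y y0).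
Proof.
move=> mY Yy0 mg; apply: (measurable_comp mY _ mg); last first.
  exact: measurable_retract.
by move=> _ [y _ <-]; exact: retract_in.
Qed.

Section ControlledChain.
Context (R : realType) (X : pseudoPMetricType R) (U : pmetricType R)
  (S : ptopologicalType).
Variables (Y : set X) (f : X -> U -> S -> X) (Uc : X -> set U).
Hypotheses (Y_compact : compact Y) (mY : measurable (Y : set (borel X)))
  (U_compact : compact [set: U])
  (f_continuous : forall x, continuous_on_prod Y (fun y u => f y u x))
  (f_borel : forall y u, Y y ->
     measurable_fun [set: borel S] (f y u : borel S -> borel X))
  (f_viable : forall y u x, Y y -> Uc y u -> Y (f y u x)).
Variables (y0 : X) (pi : nat -> X -> U).
Hypotheses (Yy0 : Y y0) (pi_plan : control_plan Y Uc pi).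

(* Everything is transported from [Y] to the whole space along [retract], so
   that the closed-loop transition becomes a total measurable map. *)
Definition closed_loop t (z : borel X * borel S) : borel X :=
  f (retract Y y0 z.1) (pi t (retract Y y0 z.1)) z.2.

Lemma closed_loop_in t z : Y (closed_loop t z).
Proof.
apply: f_viable; first exact: retract_in.
by apply: (pi_plan t).2; exact: retract_in.
Qed.

Let measurable_retractX :
  measurable_fun setT (retract Y y0 : borel X -> borel X).
Proof. exact: measurable_retract. Qed.

Lemma measurable_plan_retract t :
  measurable_fun setT (pi t \o retract Y y0 : borel X -> borel U).
Proof. exact: (measurable_comp_retract mY Yy0 (pi_plan t).1). Qed.

(** Joint measurability in state and noise is tested against continuous real [phi]: then [phi] after
    [f] is continuous in state and control and measurable in the noise. *)
Lemma measurable_closed_loop t : measurable_fun setT (closed_loop t).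
Proof.
apply: measurable_fun_borel_target => phi cphi.
apply: (@measurable_fun_caratheodory R X U Y _ (borel X * borel S)%type
  _ (borel S) (fun y u x => phi (f y u x)) (fun z => retract Y y0 z.1)
  (fun z => pi t (retract Y y0 z.1)) snd) => //.
- move=> x; apply/subspace_continuousP => z Yz.
  have /subspace_continuousP/(_ z Yz) fz := @f_continuous x.
  exact: (cvg_comp _ _ fz (cphi _)).
- move=> y u Yy; apply: (measurableT_comp (f := phi : borel X -> R)).
    exact: continuous_borel_measurable.
  exact: f_borel.
- exact: (measurableT_comp measurable_retractX
    (@measurable_fst _ _ _ (borel S))).
- exact: (measurableT_comp (measurable_plan_retract t)
    (@measurable_fst _ _ _ (borel S))).
- by move=> z; exact: retract_in.
Qed.

Lemma state_in (Omega : Type) (s : nat -> Omega -> S) t w :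
  Y (state f s pi y0 t w).
Proof.
elim: t => //= t IH; apply: f_viable => //.
by apply: (pi_plan t).2.
Qed.

Lemma state_closed_loop (Omega : Type) (s : nat -> Omega -> S) t w :
  state f s pi y0 t.+1 w = closed_loop t (state f s pi y0 t w, s t w).
Proof. by rewrite /closed_loop /= retract_id//; exact: state_in. Qed.

Context d (Omega : measurableType d) (P : probability Omega R)
  (nu : probability (borel S) R) (s : nat -> {RV P >-> borel S}).
Hypotheses (s_law : forall t, has_law nu (s t))
  (s_indep : mutually_independent s).

Let y := state f s pi y0.
Let u := control f s pi y0.

Let Yy t w : Y (y t w). Proof. exact: state_in. Qed.

Let yS t w : y t.+1 w = closed_loop t (y t w, s t w).
Proof. exact: state_closed_loop. Qed.

Lemma measurable_state t : measurable_fun setT (y t : Omega -> borel X).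
Proof. exact: (chain_measurable measurable_closed_loop (erefl _) yS). Qed.

Definition state_rv t : {RV P >-> borel X} :=
  HB.pack (y t : Omega -> borel X)
    (isMeasurableFun.Build _ _ _ _ _ (measurable_state t)).

Lemma state_independent t A B : measurable A -> measurable B ->
  P (state_rv t @^-1` A `&` s t @^-1` B) = (P (state_rv t @^-1` A) * nu B)%E.
Proof.
move=> mA mB; rewrite -(s_law t mB).
exact: (chain_independent s_indep measurable_closed_loop (erefl _) yS).
Qed.

Lemma measurable_control t : measurable_fun setT (u t : Omega -> borel U).
Proof.
rewrite (_ : u t = (pi t \o retract Y y0) \o y t).
  exact: (measurableT_comp (measurable_plan_retract t) (measurable_state t)).
by apply/funext => w; rewrite /= retract_id.
Qed.

Lemma measurable_running_cost (k : X -> U -> R) t : continuous_on_prod Y k ->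
  measurable_fun setT (fun w => k (y t w) (u t w)).
Proof.
move=> ck.
(* The noise variable is a dummy here, filled by the identity of [Omega]. *)
apply: (@measurable_fun_caratheodory R X U Y _ Omega _ Omega
  (fun y u _ => k y u) (y t) (u t) id) => //.
- exact: measurable_state.
- exact: measurable_control.
Qed.

Section BoundedBorel.
Variables (phi : X -> R) (M : R).
Hypotheses (mphi : measurable_fun (Y : set (borel X)) phi)
  (phiM : forall y, Y y -> `|phi y| <= M).

Let mphir : measurable_fun setT (phi \o retract Y y0 : borel X -> R).
Proof. exact: (measurable_comp_retract mY Yy0 mphi). Qed.

Let phirE z : Y z -> (phi \o retract Y y0) z = phi z.
Proof. by move=> Yz; rewrite /= retract_id. Qed.

Lemma measurable_fun_state t : measurable_fun setT (fun w => phi (y t w)).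
Proof.
rewrite (_ : (fun w => _) = (phi \o retract Y y0) \o y t).
  exact: (measurableT_comp mphir (measurable_state t)).
by apply/funext => w; rewrite /= retract_id.
Qed.

Let H t z := phi (closed_loop t z).

Let mH t : measurable_fun setT (H t).
Proof.
rewrite (_ : H t = (phi \o retract Y y0) \o closed_loop t).
  exact: (measurableT_comp mphir (measurable_closed_loop t)).
by apply/funext => z; rewrite /H /= retract_id//; exact: closed_loop_in.
Qed.

Let HM t z : `|H t z| <= M.
Proof. by apply: phiM; exact: closed_loop_in. Qed.

Let HE t w x : H t (y t w, x) = phi (f (y t w) (u t w) x).
Proof. by rewrite /H /closed_loop /= retract_id. Qed.

Lemma measurable_transition t :
  measurable_fun setT (fun w => \int[nu]_x phi (f (y t w) (u t w) x)).
Proof.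
rewrite (_ : (fun w => _) = (fun z => \int[nu]_x H t (z, x)) \o y t).
  apply: (measurableT_comp _ (measurable_state t)).
  exact: (measurable_Rintegral_snd (state_rv t) nu (mH t) (HM t)).
by apply/funext => w /=; apply: eq_Rintegral => x _; rewrite HE.
Qed.

Lemma bounded_transition t w : `|\int[nu]_x phi (f (y t w) (u t w) x)| <= M.
Proof.
rewrite (eq_Rintegral nu (g := fun x => H t (y t w, x))); last first.
  by move=> x _; rewrite HE.
apply: bounded_Rintegral => //.
exact: (measurableT_comp (mH t) (@pair1_measurable _ _ (borel X) _ (y t w))).
Qed.

(** The bridge between conditioning on the state and the integral over [nu] in the dual
    constraints. *)
Lemma cond_expectation_state t :
  is_cond_expectation P (fun w => phi (f (y t w) (u t w) (s t w)))
    (y t : Omega -> borel X)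
    (fun w => \int[nu]_x phi (f (y t w) (u t w) x)).
Proof.
have := cond_expectation_freezing (@state_independent t) (mH t) (HM t).
rewrite (_ : (fun w => H t _) = (fun w => phi (f (y t w) (u t w) (s t w)))).
  rewrite (_ : (fun w => \int[nu]_x H t _) =
    (fun w => \int[nu]_x phi (f (y t w) (u t w) x)))//.
  by apply/funext => w; apply: eq_Rintegral => x _; exact: HE.
by apply/funext => w; exact: HE.
Qed.

Lemma Rintegral_state_succ t :
  \int[P]_w phi (y t.+1 w) = \int[P]_w \int[nu]_x phi (f (y t w) (u t w) x).
Proof.
have [_ _ /(_ setT measurableT)] := cond_expectation_state t.
by rewrite preimage_setT /Rintegral => ->.
Qed.

(** Periodicity is assumed for continuous functions only, while [phi] is merely Borel; the passage
    goes through equality of the laws of the two states. *)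
Lemma Rintegral_state_periodic T0 period t :
  periodic_regime Y P f s pi y0 T0 period -> (T0 <= t)%N ->
  \int[P]_w phi (y (t + period)%N w) = \int[P]_w phi (y t w).
Proof.
move=> per T0t.
have law t' : (\int[P]_w (phi (y t' w))%:E =
    \int[distribution P (state_rv t')]_z (phi (retract Y y0 z))%:E)%E.
  rewrite integral_distribution//=; first last.
  - apply: (@bounded_integrable _ _ _ P
      (fun w => phi (retract Y y0 (y t' w))) M).
      exact: (measurableT_comp mphir (measurable_state t')).
    by move=> w; apply: phiM; exact: retract_in.
  - by apply/measurable_EFinP.
  by apply: eq_integral => w _; rewrite retract_id.
rewrite /Rintegral !law; congr fine; apply: eq_measure_integral => A mA _.
apply: eq_continuous_integrals_eq_law mA => q cq q1.
have qE t' : (\int[distribution P (state_rv t')]_z (q z)%:E =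
    'E_P[fun w => q (y t' w)])%E.
  rewrite unlock integral_distribution//.
    by apply/measurable_EFinP; exact: continuous_borel_measurable.
  apply: (@bounded_integrable _ _ _ P (fun w => q (y t' w)) 1) => //.
  exact: (measurableT_comp (continuous_borel_measurable cq)
    (measurable_state t')).
rewrite !qE; apply/esym.
(* A test function of the state alone, constant in the control. *)
apply: (per (fun z _ => q z) _ t T0t).
apply: continuous_subspaceT => z.
by apply: continuous_comp; [exact: cvg_fst|exact: cq].
Qed.

End BoundedBorel.

End ControlledChain.

(** * Complementary slackness along the optimal trajectory *)

Lemma continuous_on_prod_bounded (R : realType) (X U : topologicalType)
    (Y : set X) (k : X -> U -> R) :
  compact Y -> compact [set: U] -> continuous_on_prod Y k ->
  exists M, forall y u, Y y -> `|k y u| <= M.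
Proof.
move=> cY cU ck; have := continuous_compact ck (compact_setX cY cU).
move=> /(@compact_bounded R R^o)[M [_ /(_ (M + 1))]].
rewrite ltrDl ltr01 => /(_ isT) kM; exists (M + 1) => y u Yy.
by apply: (kM (k y u)); exists (y, u).
Qed.

(* The library gives matrices both structures, but not their join. *)
HB.instance Definition _ (R : realType) (m n : nat) :=
  PseudoMetric.on 'M[R]_(m, n).

Theorem proposition6p3 (R : realType) (n : nat)
  (* data of the control system *)
  (Y : set 'rV[R]_n) (U : pmetricType R) (S : ptopologicalType)
  (f : 'rV[R]_n -> U -> S -> 'rV[R]_n) (Uc : 'rV[R]_n -> set U)
  (k : 'rV[R]_n -> U -> R)
  (Y_nonempty : Y !=set0) (Y_compact : compact Y)
  (U_compact : compact [set: U]) (S_polish : polish R S)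
  (f_bounded : exists M : R, forall y u x, Y y -> `|f y u x| <= M)
  (f_continuous : forall x, continuous_on_prod Y (fun y u => f y u x))
  (f_borel : forall y u, Y y ->
     measurable_fun [set: borel S] (f y u : borel S -> borel 'rV[R]_n))
  (Uc_usc : upper_semicontinuous_map Y Uc)
  (Uc_nonempty : forall y, Y y -> Uc y !=set0)
  (Uc_compact : forall y, Y y -> compact (Uc y))
  (f_viable : forall y u x, Y y -> Uc y u -> Y (f y u x))
  (k_continuous : continuous_on_prod Y k)
  (* the i.i.d. random elements s(0), s(1), ... with common law nu *)
  (d : measure_display) (Omega : measurableType d) (P : probability Omega R)
  (nu : probability (borel S) R) (s : nat -> {RV P >-> borel S})
  (s_law : forall t, has_law nu (s t)) (s_indep : mutually_independent s)
  (* the initial state, the dual optimal solution, and the control plan *)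
  (y0 : 'rV[R]_n) (Yy0 : Y y0)
  (psi eta : 'rV[R]_n -> R)
  (psi_eta_optimal : dual_optimal Y Uc nu f k y0 psi eta)
  (pi : nat -> 'rV[R]_n -> U) (pi_plan : control_plan Y Uc pi)
  (T0 period : nat) (period_gt0 : (0 < period)%N)
  (pi_periodic : periodic_regime Y P f s pi y0 T0 period)
  (pi_optimal : average_cost P f s k pi y0 = optimal_cost Y Uc P f s k y0)
  (no_gap : optimal_cost Y Uc P f s k y0 = dual_value Y Uc nu f k y0) :
  let y := state f s pi y0 in
  let u := control f s pi y0 in
  forall t, (T0 <= t)%N ->
    {ae P, forall w : Omega,
      (k (y t w) (u t w) + (psi y0 - psi (y t w))
       + cond_expectation P (fun w' => eta (f (y t w') (u t w') (s t w')))
           (y t : Omega -> borel 'rV[R]_n) w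
       - eta (y t w))%:E = dual_value Y Uc nu f k y0}
    /\ ('E_P[fun w => psi (y t w)] = (psi y0)%:E)%E.
Proof.
move=> y u.
have mY : measurable (Y : set (borel 'rV[R]_n)).
  rewrite -(setCK Y); apply: measurableC; apply: sub_sigma_algebra.
  by rewrite openC; apply: compact_closed => //; exact: norm_hausdorff.
have [[mpsi [M1 psiM]] [meta [M2 etaM]] psi_eta_ge] := psi_eta_optimal.
have [M0 kM] := continuous_on_prod_bounded Y_compact U_compact k_continuous.
have Yy t w : Y (y t w) by exact: (state_in f_viable Yy0 pi_plan).
have Ucu t w : Uc (y t w) (u t w) by exact: (pi_plan t).2.
have mk t : measurable_fun setT (fun w => k (y t w) (u t w)).
  exact: (measurable_running_cost Y_compact mY U_compact f_continuous f_borel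
    f_viable Yy0 pi_plan).
have kyM t w : `|k (y t w) (u t w)| <= M0 by exact: kM.
pose Ipsi t w := \int[nu]_x psi (f (y t w) (u t w) x).
pose Ieta t w := \int[nu]_x eta (f (y t w) (u t w) x).
have mpsiy t : measurable_fun setT (fun w => psi (y t w)).
  exact: (measurable_fun_state Y_compact mY U_compact f_continuous f_borel
    f_viable Yy0 pi_plan).
have metay t : measurable_fun setT (fun w => eta (y t w)).
  exact: (measurable_fun_state Y_compact mY U_compact f_continuous f_borel
    f_viable Yy0 pi_plan).
have mIpsi t : measurable_fun setT (Ipsi t).
  exact: (measurable_transition Y_compact mY U_compact f_continuous f_borel
    f_viable Yy0 pi_plan nu s mpsi psiM).
have mIeta t : measurable_fun setT (Ieta t).
  exact: (measurable_transition Y_compact mY U_compact f_continuous f_borel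
    f_viable Yy0 pi_plan nu s meta etaM).
have IpsiM t w : `|Ipsi t w| <= M1.
  exact: (bounded_transition Y_compact mY U_compact f_continuous f_borel
    f_viable Yy0 pi_plan nu s mpsi psiM).
have IetaM t w : `|Ieta t w| <= M2.
  exact: (bounded_transition Y_compact mY U_compact f_continuous f_borel
    f_viable Yy0 pi_plan nu s meta etaM).
pose K t := \int[P]_w k (y t w) (u t w).
pose b t := \int[P]_w psi (y t w).
pose e t := \int[P]_w eta (y t w).
have Kper t : (T0 <= t)%N -> K (t + period)%N = K t.
  move=> T0t; have := pi_periodic k k_continuous t T0t.
  rewrite unlock /K /Rintegral => E.
  by congr fine; apply/esym.
have eper t : (T0 <= t)%N -> e (t + period)%N = e t.
  exact: (Rintegral_state_periodic Y_compact mY U_compact f_continuous f_borel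
    f_viable Yy0 pi_plan meta etaM pi_periodic).
have bS t : b t.+1 = \int[P]_w Ipsi t w.
  exact: (Rintegral_state_succ Y_compact mY U_compact f_continuous f_borel
    f_viable Yy0 pi_plan s_law s_indep mpsi psiM).
have eS t : e t.+1 = \int[P]_w Ieta t w.
  exact: (Rintegral_state_succ Y_compact mY U_compact f_continuous f_borel
    f_viable Yy0 pi_plan s_law s_indep meta etaM).
(* The mean cost over one period; the upper limit defining the average cost is a true limit with
   this value. *)
pose c := period%:R^-1 * \sum_(i < period) K (T0 + i)%N.
have avg : average_cost P f s k pi y0 = c%:E.
  have cK : (fun T : nat => (T%:R^-1 * \sum_(i < T) K i)%:E) @ \oo --> c%:E.
    apply: cvg_EFin; first exact: nearW.
    exact: cvg_average_periodic.
  rewrite /average_cost (_ : (fun T : nat => _) =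
      (fun T : nat => (T%:R^-1 * \sum_(i < T) K i)%:E)).
    by rewrite is_cvg_limn_esupE; [exact: cvg_lim cK|exact: cvgP cK].
  apply/funext => T; rewrite EFinM; congr (_ * _)%E; rewrite unlock -sumEFin.
  under eq_integral do rewrite -sumEFin.
  rewrite integral_sum//; last first.
    by move=> i; exact: bounded_integrable (mk i) (kyM i).
  apply: eq_bigr => i _.
  by rewrite /K (EFin_bounded_Rintegral P (mk i) (kyM i)).
(* The dual value is thereby finite, and the extended-real constraint becomes an inequality between
   reals. *)
have dualE : dual_value Y Uc nu f k y0 = c%:E by rewrite -no_gap -pi_optimal.
(* The slack is written with the explicit version [Ieta]; the chosen conditional expectation
   replaces it, almost surely, only at the end. *)
pose J t w := k (y t w) (u t w) + (psi y0 - psi (y t w)) + Ieta t w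
  - eta (y t w) - c.
have J0 t w : 0 <= J t w.
  have [+ _] := psi_eta_ge (y t w, u t w) (conj (Yy t w) (Ucu t w)).
  by rewrite dualE lee_fin -subr_ge0.
have ik t := bounded_integrable P (mk t) (kyM t).
have ipsi t := bounded_integrable P (mpsiy t) (fun w => psiM _ (Yy t w)).
have ieta t := bounded_integrable P (metay t) (fun w => etaM _ (Yy t w)).
have iIpsi t := bounded_integrable P (mIpsi t) (IpsiM t).
have iIeta t := bounded_integrable P (mIeta t) (IetaM t).
have icst a : P.-integrable setT (EFin \o cst a).
  by apply: (bounded_integrable P (M := `|a|)).
have Icst a : \int[P]_w cst a w = a.
  by rewrite Rintegral_cst//= probability_setT mulr1.
(* The second dual constraint, integrated along the trajectory. *)
have b_mono t : b t <= b t.+1.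
  rewrite bS; apply: le_Rintegral => // w _; rewrite -subr_ge0.
  by have [] := psi_eta_ge (y t w, u t w) (conj (Yy t w) (Ucu t w)).
have b0E : b 0%N = psi y0 by rewrite -[RHS]Icst.
have b_ge t : psi y0 <= b t.
  by rewrite -b0E; elim: t => // t IH; exact: le_trans (b_mono t).
have mJ t : measurable_fun setT (J t).
  apply: measurable_funB => //; apply: measurable_funB => //.
  apply: measurable_funD => //; apply: measurable_funD => //.
  exact: measurable_funB.
have JM t w : `|J t w| <= M0 + (`|psi y0| + M1) + M2 + M2 + `|c|.
  rewrite /J (le_trans (ler_normB _ _))// lerD// (le_trans (ler_normB _ _))//.
  rewrite lerD ?etaM// (le_trans (ler_normD _ _))// lerD//.
  rewrite (le_trans (ler_normD _ _))// lerD// (le_trans (ler_normB _ _))//.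
  by rewrite lerD// psiM.
have IJ t : \int[P]_w J t w = K t + (psi y0 - b t) + e t.+1 - e t - c.
  have i1 : P.-integrable setT (EFin \o (fun w => psi y0 - psi (y t w))).
    exact: (integrableB measurableT (icst _) (ipsi t)).
  have i2 := integrableD measurableT (ik t) i1.
  have i3 := integrableD measurableT i2 (iIeta t).
  have i4 := integrableB measurableT i3 (ieta t).
  rewrite /J (RintegralB measurableT i4 (icst c)).
  rewrite (RintegralB measurableT i3 (ieta t)).
  rewrite (RintegralD measurableT i2 (iIeta t)).
  rewrite (RintegralD measurableT (ik t) i1).
  by rewrite (RintegralB measurableT (icst (psi y0)) (ipsi t)) !Icst eS.
have slack := periodic_slackness period_gt0 Kper eper b_ge (erefl c).
have {}slack t : (T0 <= t)%N -> \int[P]_w J t w = 0 /\ b t = psi y0.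
  rewrite IJ; apply: slack => t'.
  by rewrite -IJ; apply: Rintegral_ge0.
move=> t /slack[IJ0 bt]; split; last first.
  by rewrite unlock -bt
    (EFin_bounded_Rintegral P (mpsiy t) (fun w => psiM _ (Yy t w))).
have := ge0_Rintegral_eq0 (mJ t) (JM t) (J0 t) IJ0.
have := cond_expectation_ae (Z := state_rv Y_compact mY U_compact f_continuous
  f_borel f_viable Yy0 pi_plan s t) (cond_expectation_state Y_compact mY
  U_compact f_continuous f_borel f_viable Yy0 pi_plan s_law s_indep meta etaM t).
apply: filterS2 => w cE Jw.
rewrite dualE; congr EFin; apply/eqP; rewrite -subr_eq0; apply/eqP.
by rewrite cE -[RHS]Jw.
Qed.
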